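(* Let $\mathbb K$ be a field of characteristic $2$, let $(\mathfrak g,[\cdot,\cdot]_{\mathfrak g},s_{\mathfrak g})$ be a finite-dimensional Lie superalgebra over $\mathbb K$, and suppose that the dual space $\mathfrak g^*$ also carries a Lie superalgebra structure $(\mathfrak g^*,[\cdot,\cdot]_{\mathfrak g^*},s_{\mathfrak g^*})$. Consider the three conditions: (1) $s_{\mathfrak g}(x)\circ \mathrm{ad}_h=[x,x\circ \mathrm{ad}_h]_{\mathfrak g}+x\circ \mathrm{ad}_{h\circ \mathrm{ad}_x}$ for all $x\in\mathfrak g_{\bar 1}$, $h\in\mathfrak g^*$; (2) $s_{\mathfrak g^*}(f)\circ \mathrm{ad}_y=[f,f\circ \mathrm{ad}_y]_{\mathfrak g^*}+f\circ \mathrm{ad}_{y\circ \mathrm{ad}_f}$ for all $y\in\mathfrak g$, $f\in\mathfrak g^*_{\bar 1}$; (3) $[x\circ \mathrm{ad}_f,y]_{\mathfrak g}=y\circ \mathrm{ad}_{f\circ \mathrm{ad}_x}+[x,y\circ \mathrm{ad}_f]_{\mathfrak g}+x\circ \mathrm{ad}_{f\circ \mathrm{ad}_y}+[x,y]_{\mathfrak g}\circ \mathrm{ad}_f$ for all $x,y\in\mathfrak g_{\bar 0}$, $f\in\mathfrak g^*$; and for all $x\in\mathfrak g_{\bar 0}$, $y\in\mathfrak g$, $f\in\mathfrak g^*_{\bar 0}$; and for all $x\in\mathfrak g_{\bar 1}$, $y\in\mathfrak g$, $f\in\mathfrak g^*_{\bar 1}$. Let $c_{\mathfrak g}:\mathfrak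 g\to\mathfrak g\otimes\mathfrak g$ be the dual of the bracket $[\cdot,\cdot]_{\mathfrak g^*}$ and $c_{\mathfrak g^*}:\mathfrak g^*\to\mathfrak g^*\otimes\mathfrak g^*$ the dual of the bracket $[\cdot,\cdot]_{\mathfrak g}$. Then conditions (1), (2) and (3) together are equivalent to: $c_{\mathfrak g}\in Z^1(\mathfrak g;\mathfrak g\otimes\mathfrak g)$ and $c_{\mathfrak g^*}\in Z^1(\mathfrak g^*;\mathfrak g^*\otimes\mathfrak g^* )$.
   Context: A Lie superalgebra in characteristic $2$ is a superspace $\mathfrak g=\mathfrak g_{\bar 0}\oplus\mathfrak g_{\bar 1}$ such that $\mathfrak g_{\bar 0}$ is a Lie algebra, $\mathfrak g_{\bar 1}$ is a $\mathfrak g_{\bar 0}$-module made two-sided by symmetry, together with a squaring $s_{\mathfrak g}:\mathfrak g_{\bar 1}\to\mathfrak g_{\bar 0}$ with $s_{\mathfrak g}(\lambda x)=\lambda^2 s_{\mathfrak g}(x)$ such that $[x,y]_{\mathfrak g}:=s_{\mathfrak g}(x+y)-s_{\mathfrak g}(x)-s_{\mathfrak g}(y)$ is bilinear on $\mathfrak g_{\bar 1}$ (this is the bracket of odd elements), and $[s_{\mathfrak g}(x),y]_{\mathfrak g}=[x,[x,y]_{\mathfrak g}]_{\mathfrak g}$ for all $x\in\mathfrak g_{\bar 1}$, $y\in\mathfrak g$. For $x\in\mathfrak g$ and $f\in\mathfrak g^*$, $f\circ \mathrm{ad}_x\in\mathfrak g^*$ is $y\mapsto f([x,y]_{\mathfrak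 g})$, and $x\circ \mathrm{ad}_f\in\mathfrak g$ is the element determined (via $\mathfrak g\cong\mathfrak g^{**}$) by $h(x\circ \mathrm{ad}_f)=[f,h]_{\mathfrak g^*}(x)$ for all $h\in\mathfrak g^*$. The dual maps are given by $\langle [f,h]_{\mathfrak g^*},x\rangle=\langle f\otimes h,c_{\mathfrak g}(x)\rangle$ and $\langle c_{\mathfrak g^*}(f),x\otimes y\rangle=\langle f,[x,y]_{\mathfrak g}\rangle$ for all $x,y\in\mathfrak g$, $f,h\in\mathfrak g^*$, where $\langle f\otimes h,x\otimes y\rangle=f(x)h(y)$. For a $\mathfrak g$-module $M$, $Z^1(\mathfrak g;M)$ is the space of linear maps $c:\mathfrak g\to M$ such that $x\cdot c(y)+y\cdot c(x)+c([x,y]_{\mathfrak g})=0$ for all $x,y\in\mathfrak g$, and $x\cdot c(x)+c(s_{\mathfrak g}(x))=0$ for all $x\in\mathfrak g_{\bar 1}$. The module $\mathfrak g\otimes\mathfrak g$ carries the action $x\cdot(a\otimes b)=[x,a]\otimes b+a\otimes[x,b]$, and similarly for $\mathfrak g^*\otimes\mathfrak g^*$ over $\mathfrak g^*$. *)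

(* Defs.v *)
From HB Require Import structures.
From mathcomp Require Import all_boot all_algebra.
From mathcomp Require Import ring.
Set Implicit Arguments.
Unset Strict Implicit.
Unset Printing Implicit Defensive.
Import GRing.Theory.
Local Open Scope ring_scope.

(* Throughout, the dual of V : vectType K is the vectType 'Hom(V, K^o). *)

Section DualSpace.
Variables (K : fieldType) (V : vectType K).
Implicit Types (x : V) (f h : 'Hom(V, K^o)).

Definition eval_at x f : K^o := f x.

Fact eval_at_linear x : linear (eval_at x).
Proof. by move=> a f h; rewrite /eval_at !lfun_simp. Qed.
HB.instance Definition _ x :=
  GRing.isLinear.Build K 'Hom(V, K^o) K^o _ (eval_at x) (eval_at_linear x).

Definition ev x : 'Hom('Hom(V, K^o), K^o) := linfun (eval_at x).

Lemma evE x f : ev x f = f x.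
Proof. by rewrite lfunE. Qed.

Fact ev_linear : linear ev.
Proof.
by move=> a x y; apply/lfunP=> f; rewrite add_lfunE scale_lfunE !evE linearP.
Qed.
HB.instance Definition _ :=
  GRing.isLinear.Build K V 'Hom('Hom(V, K^o), K^o) _ ev ev_linear.

Definition basis_vec (i : 'I_(\dim {:V})) : V := (vbasis {:V})`_i.

Definition dual_vec (i : 'I_(\dim {:V})) : 'Hom(V, K^o) :=
  linfun (coord (vbasis {:V}) i : V -> K^o).

Lemma dual_vecE i x : dual_vec i x = coord (vbasis {:V}) i x.
Proof. by rewrite lfunE. Qed.

Lemma basis_vec_expand x : x = \sum_i dual_vec i x *: basis_vec i.
Proof.
rewrite {1}(coord_vbasis (memvf x)); apply: eq_bigr => i _.
by rewrite dual_vecE.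
Qed.

Lemma dual_vec_basis i j : dual_vec i (basis_vec j) = (i == j)%:R.
Proof. by rewrite dual_vecE coord_free ?(basis_free (vbasisP _)) // eq_sym. Qed.

Lemma dual_vec_expand f : f = \sum_i f (basis_vec i) *: dual_vec i.
Proof.
apply/lfunP=> x; rewrite {1}(basis_vec_expand x) linear_sum sum_lfunE.
apply: eq_bigr => i _; rewrite linearZ scale_lfunE.
by rewrite /GRing.scale /= mulrC.
Qed.

Lemma dual_sep x y : (forall f, f x = f y) -> x = y.
Proof.
move=> fxy; rewrite (basis_vec_expand x) (basis_vec_expand y).
by apply: eq_bigr => i _; rewrite fxy.
Qed.

Definition bidual : 'Hom(V, 'Hom('Hom(V, K^o), K^o)) := linfun ev.

Lemma bidualK : cancel bidual bidual^-1%VF.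
Proof.
apply: lker0_lfunK; apply/lker0P=> x y; rewrite !lfunE /= => e.
by apply: dual_sep => f; rewrite -!evE e.
Qed.

Lemma bidualVK : cancel bidual^-1%VF bidual.
Proof.
move=> phi; apply: limg_lfunVK.
suff -> : phi = bidual (\sum_i phi (dual_vec i) *: basis_vec i).
  exact: memv_img (memvf _).
apply/lfunP=> f; rewrite lfunE /= evE {1}(dual_vec_expand f) !linear_sum.
apply: eq_bigr => i _; rewrite !linearZ /=.
by rewrite /GRing.scale /= mulrC.
Qed.

Definition ann (U : {vspace V}) : {vspace 'Hom(V, K^o)} :=
  (\bigcap_(i < \dim U) lker (ev (vbasis U)`_i))%VS.

Lemma annP (U : {vspace V}) f : reflect {in U, forall x, f x = 0} (f \in ann U).
Proof.
rewrite memvE; apply: (iffP subv_bigcapP) => [h x xU | h i _].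
  rewrite (coord_vbasis xU) linear_sum big1 // => i _; rewrite linearZ /=.
  by have := h i isT; rewrite -memvE memv_ker evE => /eqP->; rewrite scaler0.
rewrite -memvE memv_ker evE h // vbasis_mem //; apply: mem_nth.
by rewrite size_tuple.
Qed.

(* The dual superspace of V0 (+) V1: functionals killing V1 are even, those
   killing V0 are odd. *)
Lemma ann_grading (V0 V1 : {vspace V}) :
  (V0 + V1)%VS = fullv -> (V0 :&: V1)%VS = 0%VS ->
  (ann V1 + ann V0)%VS = fullv /\ (ann V1 :&: ann V0)%VS = 0%VS.
Proof.
move=> sumV capV; have capV' : (V1 :&: V0 = 0)%VS by rewrite capvC.
have piE x : daddv_pi V0 V1 x + daddv_pi V1 V0 x = x.
  by rewrite daddv_pi_add // sumV memvf.
split; apply/eqP.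
  rewrite eqEsubv subvf /=; apply/subvP=> f _.
  apply/memv_addP; exists (f \o daddv_pi V0 V1)%VF.
    apply/annP=> x xV1; have := piE x; rewrite (daddv_pi_id capV') //.
    by rewrite comp_lfunE -[RHS]add0r => /addIr->; rewrite linear0.
  exists (f \o daddv_pi V1 V0)%VF.
    apply/annP=> x xV0; have := piE x; rewrite (daddv_pi_id capV) //.
    by rewrite comp_lfunE -[RHS]addr0 => /addrI->; rewrite linear0.
  by apply/lfunP=> x; rewrite add_lfunE !comp_lfunE -linearD piE.
rewrite -subv0; apply/subvP=> f /memv_capP[/annP f1 /annP f0].
rewrite memv0; apply/eqP/lfunP=> x; rewrite zero_lfunE -(piE x) linearD /=.
by rewrite f0 ?memv_pi // f1 ?memv_pi // addr0.
Qed.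

End DualSpace.

Arguments bidual {K V}.

(* A finite-dimensional model of the tensor product: coordinates in the product
   basis.  The universal property is tlift_tensor and tensor_ext below. *)
Section Tensor.
Variable K : fieldType.
Implicit Types V W U : vectType K.

Definition tens V W : vectType K := 'M[K]_(\dim {:V}, \dim {:W}).

Definition tensor V W (v : V) (w : W) : tens V W :=
  \matrix_(i, j) (dual_vec i v * dual_vec j w).

(* For b bilinear, the linear map with v (x) w |-> b v w. *)
Definition tlift V W U (b : V -> W -> U) (t : tens V W) : U :=
  \sum_i \sum_j (t : 'M_(_, _)) i j *: b (basis_vec i) (basis_vec j).

Fact tlift_linear V W U (b : V -> W -> U) : linear (tlift b).
Proof.
move=> a s t; rewrite /tlift scaler_sumr -big_split; apply: eq_bigr => i _ /=.
rewrite scaler_sumr -big_split; apply: eq_bigr => j _ /=.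
by rewrite !mxE scalerDl scalerA.
Qed.
HB.instance Definition _ V W U b :=
  GRing.isLinear.Build K (tens V W) U _ (tlift b) (@tlift_linear V W U b).

Lemma tlift_tensor V W U (b : V -> W -> U) v w :
  (forall v', linear (b v')) -> (forall w', linear (b^~ w')) ->
  tlift b (tensor v w) = b v w.
Proof.
move=> bl br.
pose bL w' := GRing.isLinear.Build K V U _ (b^~ w') (br w').
pose bR v' := GRing.isLinear.Build K W U _ (b v') (bl v').
pose BL w' : {linear V -> U} := HB.pack (b^~ w') (bL w').
pose BR v' : {linear W -> U} := HB.pack (b v') (bR v').
rewrite {2}(basis_vec_expand v) -[RHS]/(BL w _) linear_sum.
apply: eq_bigr => i _; rewrite linearZ /= {2}(basis_vec_expand w).
rewrite -[b _ _]/(BR (basis_vec i) _) linear_sum scaler_sumr.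
by apply: eq_bigr => j _; rewrite linearZ /= mxE scalerA.
Qed.

Lemma tensor_expand V W (t : tens V W) : t = tlift (@tensor V W) t.
Proof.
apply/matrixP=> k l; rewrite /tlift summxE (bigD1 k) //= summxE (bigD1 l) //=.
rewrite !mxE !dual_vec_basis !eqxx !mulr1 !big1 ?addr0 // => i nik.
  by rewrite summxE big1 // => j _; rewrite !mxE !dual_vec_basis eq_sym
    (negPf nik) mul0r mulr0.
by rewrite !mxE !dual_vec_basis [l == i]eq_sym (negPf nik) !mulr0.
Qed.

Lemma tensor_ext V W U (F G : {linear tens V W -> U}) :
  (forall v w, F (tensor v w) = G (tensor v w)) -> F =1 G.
Proof.
move=> FG t; rewrite (tensor_expand t) /tlift !linear_sum.
apply: eq_bigr => i _; rewrite !linear_sum; apply: eq_bigr => j _.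
by rewrite !linearZ FG.
Qed.

(* <f (x) h, x (x) y> = f(x) h(y), extended bilinearly. *)
Definition tpair V (s : tens 'Hom(V, K^o) 'Hom(V, K^o)) (t : tens V V) : K^o :=
  tlift (fun f h : 'Hom(V, K^o) => tlift (fun x y => f x * h y : K^o) t) s.

Lemma tpair_tensor V (f h : 'Hom(V, K^o)) (x y : V) :
  tpair (tensor f h) (tensor x y) = f x * h y.
Proof.
rewrite /tpair tlift_tensor => [|f' a u v|h' a u v].
- by rewrite tlift_tensor // => [x'|y'] a u v;
    rewrite linearP /= /GRing.scale /=; ring.
- rewrite /tlift scaler_sumr -big_split; apply: eq_bigr => i _ /=.
  rewrite scaler_sumr -big_split; apply: eq_bigr => j _ /=.
  by rewrite !lfun_simp /GRing.scale /=; ring.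
rewrite /tlift scaler_sumr -big_split; apply: eq_bigr => i _ /=.
rewrite scaler_sumr -big_split; apply: eq_bigr => j _ /=.
by rewrite !lfun_simp /GRing.scale /=; ring.
Qed.

Lemma tpairDl V (s s' : tens 'Hom(V, K^o) 'Hom(V, K^o)) (t : tens V V) :
  tpair (s + s') t = tpair s t + tpair s' t.
Proof. exact: linearD. Qed.

Lemma tpairZl V a (s : tens 'Hom(V, K^o) 'Hom(V, K^o)) (t : tens V V) :
  tpair (a *: s) t = a * tpair s t.
Proof. exact: linearZ. Qed.

Lemma tpair_suml V (I : finType) (F : I -> tens 'Hom(V, K^o) 'Hom(V, K^o))
  (t : tens V V) : tpair (\sum_i F i) t = \sum_i tpair (F i) t.
Proof. exact: linear_sum. Qed.

Fact tpair_linear V (s : tens 'Hom(V, K^o) 'Hom(V, K^o)) :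
  linear (tpair s : tens V V -> K^o).
Proof.
move=> a t t'; rewrite /tpair {1 3 5}/tlift.
rewrite scaler_sumr -big_split; apply: eq_bigr => i _ /=.
rewrite scaler_sumr -big_split; apply: eq_bigr => j _ /=.
by rewrite linearP scalerDr !scalerA mulrC.
Qed.
HB.instance Definition _ V s :=
  GRing.isLinear.Build K (tens V V) K^o _ (tpair s) (@tpair_linear V s).

Lemma tpair_sep V (t t' : tens V V) :
  (forall f h : 'Hom(V, K^o), tpair (tensor f h) t = tpair (tensor f h) t') ->
  t = t'.
Proof.
move=> e; apply/matrixP=> i j; have := e (dual_vec i) (dual_vec j).
have P u : tpair (tensor (dual_vec i) (dual_vec j)) u = (u : 'M_(_, _)) i j.
  rewrite {1}(tensor_expand u) /tlift linear_sum (bigD1 i) //= linear_sum.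
  rewrite (bigD1 j) //= linearZ /= tpair_tensor !dual_vec_basis !eqxx.
  rewrite !big1 ?addr0 => [|k nk|k nk]; first by rewrite /GRing.scale /= !mulr1.
    rewrite linear_sum big1 // => l _; rewrite linearZ /= tpair_tensor.
    by rewrite !dual_vec_basis [i == k]eq_sym (negPf nk) mul0r scaler0.
  rewrite linearZ /= tpair_tensor !dual_vec_basis [j == k]eq_sym (negPf nk).
  by rewrite mulr0 scaler0.
by rewrite !P.
Qed.

Lemma tpair_sep_dual V (s s' : tens 'Hom(V, K^o) 'Hom(V, K^o)) :
  (forall x y : V, tpair s (tensor x y) = tpair s' (tensor x y)) -> s = s'.
Proof.
move=> e; pose F (u : tens 'Hom(V, K^o) 'Hom(V, K^o)) :
    tens 'Hom(V, K^o) 'Hom(V, K^o) :=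
  \sum_i \sum_j tpair u (tensor (basis_vec i) (basis_vec j))
    *: tensor (dual_vec i) (dual_vec j).
have Fl : linear F.
  move=> a u v; rewrite /F scaler_sumr -big_split; apply: eq_bigr => i _ /=.
  rewrite scaler_sumr -big_split; apply: eq_bigr => j _ /=.
  by rewrite tpairDl tpairZl scalerDl scalerA.
pose FL : {linear tens 'Hom(V, K^o) 'Hom(V, K^o) -> _} :=
  HB.pack F (GRing.isLinear.Build K _ _ _ F Fl).
suff FE u : F u = u.
  rewrite -(FE s) -(FE s') /F; apply: eq_bigr => i _; apply: eq_bigr => j _.
  by rewrite e.
apply: (tensor_ext (F := FL) (G := idfun)) => f h /=; apply/matrixP=> k l.
rewrite /F summxE mxE [f in RHS]dual_vec_expand [h in RHS]dual_vec_expand.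
rewrite !linear_sum mulr_suml; apply: eq_bigr => i _.
rewrite summxE mulr_sumr; apply: eq_bigr => j _.
by rewrite tpair_tensor !linearZ !mxE; apply: mulrACA.
Qed.

End Tensor.

Definition bil (K : fieldType) (V : vectType K) (B : 'Hom(V, 'End(V)))
  (x y : V) : V := (B x : 'End(V)) y.

(* Lie superalgebra structures on V = V0 (+) V1 in characteristic 2.  The
   bracket is total: it collects the bracket of V0, the two-sided action of V0
   on V1 and the polarization of the squaring.  lie_sq is only constrained, and
   only to be used, on V1. *)
Record lie_super (K : fieldType) (V : vectType K) (V0 V1 : {vspace V}) :=
LieSuper {
  lie_hom : 'Hom(V, 'End(V));
  lie_sq : V -> V;
  lie_sum : (V0 + V1)%VS = fullv;
  lie_cap : (V0 :&: V1)%VS = 0%VS;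
  lie_even : {in V0 &, forall x y, bil lie_hom x y \in V0};
  lie_alt : {in V0, forall x, bil lie_hom x x = 0};
  lie_jacobi : {in V0 & &, forall x y z,
    bil lie_hom x (bil lie_hom y z) + bil lie_hom y (bil lie_hom z x)
      + bil lie_hom z (bil lie_hom x y) = 0};
  lie_odd : {in V0 & V1, forall x y, bil lie_hom x y \in V1};
  lie_act : {in V0 & V0 & V1, forall x y z,
    bil lie_hom (bil lie_hom x y) z =
      bil lie_hom x (bil lie_hom y z) - bil lie_hom y (bil lie_hom x z)};
  lie_sym : {in V0 & V1, forall x y, bil lie_hom y x = bil lie_hom x y};
  lie_sq_even : {in V1, forall x, lie_sq x \in V0};
  lie_sqZ : {in V1, forall x (a : K), lie_sq (a *: x) = a ^+ 2 *: lie_sq x};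
  lie_polar : {in V1 &, forall x y,
    bil lie_hom x y = lie_sq (x + y) - lie_sq x - lie_sq y};
  lie_sq_ad : {in V1, forall x y,
    bil lie_hom (lie_sq x) y = bil lie_hom x (bil lie_hom x y)}
}.

Section LieSuper.
Variables (K : fieldType) (V : vectType K) (V0 V1 : {vspace V}).
Implicit Type L : lie_super V0 V1.

Definition ad L (x : V) : 'End(V) := lie_hom L x.

Definition lie L (x y : V) : V := ad L x y.

Definition dual_ad L (f : 'Hom(V, K^o)) (x : V) : 'Hom(V, K^o) :=
  (f \o ad L x)%VF.

Lemma dual_adE L f x y : dual_ad L f x y = f (lie L x y).
Proof. by rewrite comp_lfunE. Qed.

Definition cocycle1 L (M : vectType K) (act : V -> M -> M) (c : 'Hom(V, M)) :=
  (forall x y, act x (c y) + act y (c x) + c (lie L x y) = 0) /\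
  {in V1, forall x, act x (c x) + c (lie_sq L x) = 0}.

Definition tens_act L (x : V) : tens V V -> tens V V :=
  tlift (fun a b => tensor (lie L x a) b + tensor a (lie L x b)).

Lemma tens_actE L x a b :
  tens_act L x (tensor a b) = tensor (lie L x a) b + tensor a (lie L x b).
Proof.
apply: tlift_tensor => [a'|b'] k u v; apply/matrixP=> i j; rewrite !mxE.
  by rewrite /lie !linearP /= /GRing.scale /=; ring.
by rewrite /lie !linearP /= /GRing.scale /=; ring.
Qed.

(* The dual V^* -> V^* (x) V^* of the bracket of V. *)
Definition cobracket_dual L : 'Hom('Hom(V, K^o), tens 'Hom(V, K^o) 'Hom(V, K^o))
  := linfun (fun f : 'Hom(V, K^o) =>
       \sum_i \sum_j f (lie L (basis_vec i) (basis_vec j))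
         *: tensor (dual_vec i) (dual_vec j)).

Lemma cobracket_dualE L (f : 'Hom(V, K^o)) x y :
  tpair (cobracket_dual L f) (tensor x y) = f (lie L x y).
Proof.
pose F (f : 'Hom(V, K^o)) : tens 'Hom(V, K^o) 'Hom(V, K^o) :=
  \sum_i \sum_j f (lie L (basis_vec i) (basis_vec j))
    *: tensor (dual_vec i) (dual_vec j).
have Fl : linear F.
  move=> a u v; rewrite /F scaler_sumr -big_split; apply: eq_bigr => i _ /=.
  rewrite scaler_sumr -big_split; apply: eq_bigr => j _ /=.
  by rewrite !lfun_simp scalerDl scalerA.
pose FL : {linear 'Hom(V, K^o) -> tens 'Hom(V, K^o) 'Hom(V, K^o)} :=
  HB.pack F (GRing.isLinear.Build K _ _ _ F Fl).
have -> : cobracket_dual L f = F f by exact: (lfunE FL f).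
rewrite /F tpair_suml [x in RHS]basis_vec_expand /lie /ad !linear_sum.
rewrite sum_lfunE linear_sum; apply: eq_bigr => i _.
rewrite tpair_suml linearZ scale_lfunE [y in RHS]basis_vec_expand !linear_sum.
apply: eq_bigr => j _; rewrite tpairZl tpair_tensor !linearZ /=.
by rewrite /GRing.scale /= mulrC mulrA.
Qed.

End LieSuper.

Section DualLieSuper.
Variables (K : fieldType) (V : vectType K).
Variables W0 W1 : {vspace 'Hom(V, K^o)}.
Implicit Type D : lie_super W0 W1.

(* The vector x o ad_f; bidual x \o ad D f is the functional h |-> [f, h] x. *)
Definition coad D (x : V) (f : 'Hom(V, K^o)) : V :=
  (bidual^-1)%VF ((bidual x : 'Hom('Hom(V, K^o), K^o)) \o ad D f)%VF.

Lemma coadE D x (f h : 'Hom(V, K^o)) : h (coad D x f) = (lie D f h : 'Hom(V, K^o)) x.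
Proof.
have bidualE y g : (bidual y : 'Hom('Hom(V, K^o), K^o)) g = g y.
  by rewrite lfunE /= evE.
by rewrite -bidualE bidualVK comp_lfunE bidualE.
Qed.

(* The dual V -> V (x) V of the bracket of V^*. *)
Definition cobracket D : 'Hom(V, tens V V) :=
  linfun (fun x : V => \sum_i \sum_j
    (lie D (dual_vec i) (dual_vec j) : 'Hom(V, K^o)) x
      *: tensor (basis_vec i) (basis_vec j)).

Lemma cobracketE D (f h : 'Hom(V, K^o)) x : tpair (tensor f h) (cobracket D x) = (lie D f h : 'Hom(V, K^o)) x.
Proof.
pose F x : tens V V := \sum_i \sum_j
  (lie D (dual_vec i) (dual_vec j) : 'Hom(V, K^o)) x
    *: tensor (basis_vec i) (basis_vec j).
have Fl : linear F.
  move=> a u v; rewrite /F scaler_sumr -big_split; apply: eq_bigr => i _ /=.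
  rewrite scaler_sumr -big_split; apply: eq_bigr => j _ /=.
  by rewrite linearP scalerDl scalerA.
pose FL : {linear V -> tens V V} :=
  HB.pack F (GRing.isLinear.Build K V (tens V V) _ F Fl).
have -> : cobracket D x = F x by exact: (lfunE FL x).
rewrite /F linear_sum [f in RHS]dual_vec_expand /lie /ad !linear_sum.
rewrite !sum_lfunE; apply: eq_bigr => i _.
rewrite !linear_sum linearZ !scale_lfunE [h in RHS]dual_vec_expand !linear_sum.
rewrite sum_lfunE scaler_sumr; apply: eq_bigr => j _.
rewrite !linearZ scale_lfunE /= tpair_tensor /GRing.scale /=.
by rewrite mulrC mulrA.
Qed.

(* For given x, y, f this is the cocycle identity of cobracket D at (x, y),
   paired with f (x) h for all h. *)
Definition compat_at (V0 V1 : {vspace V}) (L : lie_super V0 V1) D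
  (x y : V) (f : 'Hom(V, K^o)) :=
  lie L (coad D x f) y =
    coad D y (dual_ad L f x) + lie L x (coad D y f)
      + coad D x (dual_ad L f y) + coad D (lie L x y) f.

End DualLieSuper.

(* Main.v *)
Require Import Defs.
From mathcomp Require Import all_boot all_algebra.
From mathcomp Require Import ring.

(** Write c for the dual of the bracket of g^*.  The cocycle identity for c at
    (x, y), paired with f (x) h, becomes the scalar identity
      [f.x, h](y) + [f, h.x](y) + [f.y, h](x) + [f, h.y](x) + [f, h]([x, y]) = 0
    where f.x stands for f o ad_x ([cocycle_form] below).  Moving every action
    to the other side of the duality turns this same scalar into the pairing
    of the cocycle identity of the dual cobracket at (f, h) with x (x) y, and
    also, letting h vary, into condition (3) at (x, y, f).  Likewise (1) at x is
    the squaring identity for c at x, and (2) at f is the squaring identity for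
    the dual cobracket at f.  So both cocycle conditions together amount to
    (1), (2) and the vanishing of [cocycle_form] at all arguments.

    What remains is that (1) and (3) already force the form to vanish at all
    arguments although (3) only covers some parities ([cocycle_form_eq0]).  The
    form is additive in x, y, f and symmetric in x and y, hence homogeneous
    arguments suffice.  Two even vectors are the first clause of (3); an even
    and an odd vector are covered, after ordering them, by the second clause
    if f is even and by the third if f is odd; for two odd vectors the form is
    the polarization of the quadratic expression in (1), because the bracket
    of odd elements is the polarization of the squaring. *)

Set Implicit Arguments.
Unset Strict Implicit.
Import GRing.Theory.
Local Open Scope ring_scope.

(** * Brackets in characteristic 2 *)

Lemma addr0_eq_pchar2 (R : nzRingType) (char2 : 2%N \in [pchar R])
    (V : lmodType R) (u v : V) : u + v = 0 -> u = v.
Proof. by move/addr0_eq <-; rewrite -scaleN1r (oppr_pchar2 char2) scale1r. Qed.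

Section LieChar2.
Variables (K : fieldType) (V : vectType K) (V0 V1 : {vspace V}).
Hypothesis char2 : 2%N \in [pchar K].
Variable L : lie_super V0 V1.
Implicit Types (x y z : V) (f : 'Hom(V, K^o)).

Lemma lieE x y : lie L x y = bil (lie_hom L) x y.
Proof. by []. Qed.

Lemma lieDl x y z : lie L (x + y) z = lie L x z + lie L y z.
Proof. by rewrite /lie /ad linearD add_lfunE. Qed.

Lemma lieDr x y z : lie L x (y + z) = lie L x y + lie L x z.
Proof. by rewrite /lie linearD. Qed.

Lemma lie_sqD x y : x \in V1 -> y \in V1 ->
  lie_sq L (x + y) = lie_sq L x + lie_sq L y + lie L x y.
Proof.
move=> xV yV; rewrite lieE (lie_polar L xV yV) -[_ - _ - _]addrA -opprD.
by rewrite [RHS]addrC subrK.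
Qed.

Lemma homogeneous_decomp x :
  exists x0 x1, [/\ x0 \in V0, x1 \in V1 & x = x0 + x1].
Proof.
have /memv_addP[x0 x0V [x1 x1V ->]] : x \in (V0 + V1)%VS.
  by rewrite (lie_sum L) memvf.
by exists x0, x1.
Qed.

(** In characteristic 2 the alternating bracket of even elements is symmetric;
    between the other parities symmetry is part of the structure or comes from
    the polarization of the squaring. *)
Lemma lieC x y : lie L x y = lie L y x.
Proof.
have [x0 [x1 [x0V x1V ->]]] := homogeneous_decomp x.
have [y0 [y1 [y0V y1V ->]]] := homogeneous_decomp y.
have lie00 : lie L x0 y0 = lie L y0 x0.
  apply: (addr0_eq_pchar2 char2); have := lie_alt L (memvD x0V y0V).
  rewrite -lieE lieDl !lieDr !lieE.
  by rewrite (lie_alt L x0V) (lie_alt L y0V) add0r addr0.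
have lie11 : lie L x1 y1 = lie L y1 x1.
  rewrite !lieE (lie_polar L x1V y1V) (lie_polar L y1V x1V).
  by rewrite [y1 + x1]addrC addrAC.
have lie01 u v : u \in V0 -> v \in V1 -> lie L u v = lie L v u.
  by move=> uV vV; rewrite !lieE (lie_sym L uV vV).
rewrite !lieDl !lieDr lie00 lie11 (lie01 x0 y1) // (lie01 y0 x1) //.
by rewrite addrACA.
Qed.

Lemma dual_adDl f h x : dual_ad L (f + h) x = dual_ad L f x + dual_ad L h x.
Proof. by apply/lfunP=> y; rewrite add_lfunE !dual_adE add_lfunE. Qed.

Lemma dual_adDr f x y : dual_ad L f (x + y) = dual_ad L f x + dual_ad L f y.
Proof. by apply/lfunP=> z; rewrite add_lfunE !dual_adE lieDl linearD. Qed.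

(** The action on the tensor square is transpose to the action on functionals
    by f |-> f o ad_x; it suffices to compare on pure tensors. *)
Lemma tpair_tens_act f h x t :
  tpair (tensor f h) (tens_act L x t) =
  tpair (tensor (dual_ad L f x) h) t + tpair (tensor f (dual_ad L h x)) t.
Proof.
rewrite -tpairDl /tens_act; set b := fun _ => _; move: t.
have := @tensor_ext K V V K^o (tpair (tensor f h) \o tlift b)
  (tpair (tensor (dual_ad L f x) h + tensor f (dual_ad L h x))).
apply=> v w /=.
rewrite -/(tens_act L x (tensor v w)) tens_actE linearD /=.
by rewrite tpairDl !tpair_tensor !dual_adE.
Qed.

End LieChar2.

(** * Both cocycle conditions as scalar identities *)

Section Compatibility.
Variables (K : fieldType) (V : vectType K) (V0 V1 : {vspace V}).
Variables (W0 W1 : {vspace 'Hom(V, K^o)}).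
Hypothesis char2 : 2%N \in [pchar K].
Variables (L : lie_super V0 V1) (D : lie_super W0 W1).
Implicit Types (x y z : V) (f h : 'Hom(V, K^o)).

(** The mirror of [tpair_tens_act]: ad_f is transpose to x |-> x o ad_f, the
    bidual playing the role of the dual. *)
Lemma tpair_tens_act_dual f (s : tens 'Hom(V, K^o) 'Hom(V, K^o)) x y :
  tpair (tens_act D f s) (tensor x y) =
  tpair s (tensor (coad D x f) y) + tpair s (tensor x (coad D y f)).
Proof.
(* For a fixed tensor t, tpair _ t unfolds to the linear map
   tlift (pairing t), the form to which the extension principle applies. *)
pose pairing (t : tens V V) (a c : 'Hom(V, K^o)) : K^o :=
  tlift (fun u v => a u * c v : K^o) t.
rewrite -linearD /=; move: s.
pose act a c := tensor (lie D f a) c + tensor a (lie D f c).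
have := @tensor_ext K _ _ K^o (tlift (pairing (tensor x y)) \o tlift act)
  (tlift (pairing (tensor (coad D x f) y + tensor x (coad D y f)))).
apply=> a c /=.
rewrite -/(tens_act D f (tensor a c)) tens_actE.
rewrite -[LHS]/(tpair (_ + _) (tensor x y)) -[RHS]/(tpair (tensor a c) (_ + _)).
by rewrite tpairDl [RHS]linearD /= !tpair_tensor !coadE.
Qed.

(** By [cobracketE] this is the pairing of f (x) h with the cobracket of x. *)
Definition copair f h : V -> K := (lie D f h : 'Hom(V, K^o)).

(** The pairing of f (x) h with x . c(y), where c is the cobracket. *)
Definition act_pairing x y f h : K :=
  copair (dual_ad L f x) h y + copair f (dual_ad L h x) y.

(** The common scalar form of both cocycle identities and of (3). *)
Definition cocycle_form x y f h : K :=
  act_pairing x y f h + act_pairing y x f h + copair f h (lie L x y).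

(** The squaring identity x . c(x) + c(s(x)) paired with f (x) h. *)
Definition sq_form x f h : K := act_pairing x x f h + copair f h (lie_sq L x).

(** The squaring identity of the dual cobracket at f, paired with x (x) y. *)
Definition dual_sq_form f x y : K :=
  copair f (dual_ad L f x) y + copair f (dual_ad L f y) x
    + (lie_sq D f : 'Hom(V, K^o)) (lie L x y).

Lemma copairC f h x : copair f h x = copair h f x.
Proof. by rewrite /copair (lieC char2). Qed.

Lemma copairDl f f' h x : copair (f + f') h x = copair f h x + copair f' h x.
Proof. by rewrite /copair lieDl add_lfunE. Qed.

Lemma copairDr f h h' x : copair f (h + h') x = copair f h x + copair f h' x.
Proof. by rewrite copairC copairDl ![copair _ f x]copairC. Qed.

Lemma copair_argD f h x y : copair f h (x + y) = copair f h x + copair f h y.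
Proof. by rewrite /copair linearD. Qed.

Lemma cocycle_formC x y f h : cocycle_form x y f h = cocycle_form y x f h.
Proof.
by rewrite /cocycle_form (lieC char2) [act_pairing x y f h + _]addrC.
Qed.

Lemma cocycle_formDl x x' y f h :
  cocycle_form (x + x') y f h = cocycle_form x y f h + cocycle_form x' y f h.
Proof.
rewrite /cocycle_form /act_pairing lieDl !dual_adDr !copair_argD copairDl.
rewrite copairDr; ring.
Qed.

Lemma cocycle_formDf x y f f' h :
  cocycle_form x y (f + f') h = cocycle_form x y f h + cocycle_form x y f' h.
Proof. rewrite /cocycle_form /act_pairing !dual_adDl !copairDl; ring. Qed.

(** Holds since s(x + y) = s(x) + s(y) + [x, y] on odd elements; this is how (1)
    supplies the case of two odd vectors. *)
Lemma sq_form_polar x y f h : x \in V1 -> y \in V1 ->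
  sq_form (x + y) f h = sq_form x f h + sq_form y f h + cocycle_form x y f h.
Proof.
move=> xV yV; rewrite /sq_form /cocycle_form /act_pairing (lie_sqD L xV yV).
rewrite !dual_adDr !copair_argD !copairDl !copairDr; ring.
Qed.

Lemma apply_lie_coad f h x y :
  h (lie L x (coad D y f)) = copair f (dual_ad L h x) y.
Proof. by rewrite /copair -coadE dual_adE. Qed.

(** Functionals separate vectors, and in characteristic 2 two scalars agree iff
    their sum is 0.  Applying h to the two sides and adding gives the form:
    h([x, v]) = (h o ad_x)(v) and h(x o ad_f) = [f, h](x), while the left-hand
    side [x o ad_f, y] first needs the symmetry of the bracket. *)
Lemma compat_atE x y f :
  compat_at L D x y f <-> forall h, cocycle_form x y f h = 0.
Proof.
have E h : cocycle_form x y f h =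
    h (lie L (coad D x f) y) + h (coad D y (dual_ad L f x)
      + lie L x (coad D y f) + coad D x (dual_ad L f y) + coad D (lie L x y) f).
  rewrite (lieC char2 L (coad _ _ _)) !linearD /= !apply_lie_coad !coadE.
  rewrite /cocycle_form /act_pairing /copair; ring.
split=> [c h | m].
  by rewrite E c (addrr_pchar2 char2).
apply: dual_sep => h; apply: (addr0_eq_pchar2 char2).
by rewrite -E m.
Qed.

Lemma coad_sqE x :
  (forall h, coad D (lie_sq L x) h =
     lie L x (coad D x h) + coad D x (dual_ad L h x)) <->
  (forall f h, sq_form x f h = 0).
Proof.
have E f h : sq_form x f h =
    h (coad D (lie_sq L x) f)
    + h (lie L x (coad D x f) + coad D x (dual_ad L f x)).
  rewrite linearD /= apply_lie_coad !coadE /sq_form /act_pairing /copair; ring.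
split=> [c f h | m h].
  by rewrite E c (addrr_pchar2 char2).
apply: dual_sep => k; apply: (addr0_eq_pchar2 char2).
by rewrite -E m.
Qed.

Lemma dual_ad_sqE f :
  (forall y, dual_ad L (lie_sq D f) y =
     lie D f (dual_ad L f y) + dual_ad L f (coad D y f)) <->
  (forall x y, dual_sq_form f x y = 0).
Proof.
have E x y : dual_sq_form f x y =
    dual_ad L (lie_sq D f) x y
    + (lie D f (dual_ad L f x) + dual_ad L f (coad D x f)) y.
  rewrite add_lfunE !dual_adE (lieC char2 L (coad _ _ _)) apply_lie_coad.
  rewrite /dual_sq_form /copair; ring.
split=> [c x y | m x].
  by rewrite E c (addrr_pchar2 char2).
apply/lfunP => y; apply: (addr0_eq_pchar2 char2).
by rewrite -E m.
Qed.

Lemma tens_eq0 (t : tens V V) :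
  (forall f h, tpair (tensor f h) t = 0) -> t = 0.
Proof. by move=> t0; apply: tpair_sep => f h; rewrite t0 linear0. Qed.

Lemma tpair0l (t : tens V V) : tpair 0 t = 0.
Proof. by rewrite -(scale0r 0) tpairZl mul0r. Qed.

Lemma tens_dual_eq0 (s : tens 'Hom(V, K^o) 'Hom(V, K^o)) :
  (forall x y, tpair s (tensor x y) = 0) -> s = 0.
Proof. by move=> s0; apply: tpair_sep_dual => x y; rewrite s0 tpair0l. Qed.

Lemma tpair_act_cobracket x y f h :
  tpair (tensor f h) (tens_act L x (cobracket D y)) = act_pairing x y f h.
Proof. by rewrite tpair_tens_act !cobracketE. Qed.

Lemma tpair_act_cobracket_dual f h x y :
  tpair (tens_act D f (cobracket_dual L h)) (tensor x y) =
  copair f (dual_ad L h x) y + copair f (dual_ad L h y) x.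
Proof.
rewrite tpair_tens_act_dual !cobracket_dualE [lie L (coad _ _ _) _](lieC char2).
by rewrite !apply_lie_coad addrC.
Qed.

Lemma cocycle1_cobracketE :
  cocycle1 L (tens_act L) (cobracket D) <->
  (forall x y f h, cocycle_form x y f h = 0) /\
  {in V1, forall x f h, sq_form x f h = 0}.
Proof.
have E x y f h : tpair (tensor f h) (tens_act L x (cobracket D y)
    + tens_act L y (cobracket D x) + cobracket D (lie L x y))
    = cocycle_form x y f h.
  by rewrite !linearD /= !tpair_act_cobracket cobracketE.
have S x f h : tpair (tensor f h) (tens_act L x (cobracket D x)
    + cobracket D (lie_sq L x)) = sq_form x f h.
  by rewrite linearD /= tpair_act_cobracket cobracketE.
split=> -[cm cs]; split.
- by move=> x y f h; rewrite -E cm linear0.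
- by move=> x xV f h; rewrite -S cs // linear0.
- by move=> x y; apply: tens_eq0 => f h; rewrite E.
by move=> x xV; apply: tens_eq0 => f h; rewrite S cs.
Qed.

(** The bracket term [f, h]([x, y]) is common to both sides of the duality, and
    the four action terms of [cocycle_form], grouped by the vector acting on
    the primal side, are here grouped by the functional acting; the symmetry
    of the bracket of functionals matches them. *)
Lemma cocycle1_cobracket_dualE :
  cocycle1 D (tens_act D) (cobracket_dual L) <->
  (forall x y f h, cocycle_form x y f h = 0) /\
  {in W1, forall f x y, dual_sq_form f x y = 0}.
Proof.
have E f h x y : tpair (tens_act D f (cobracket_dual L h)
    + tens_act D h (cobracket_dual L f) + cobracket_dual L (lie D f h))
    (tensor x y) = cocycle_form x y f h.
  rewrite !tpairDl !tpair_act_cobracket_dual cobracket_dualE.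
  rewrite /cocycle_form /act_pairing ![copair h _ _]copairC.
  rewrite -/(copair f h _); ring.
have S f x y : tpair (tens_act D f (cobracket_dual L f)
    + cobracket_dual L (lie_sq D f)) (tensor x y) = dual_sq_form f x y.
  by rewrite tpairDl tpair_act_cobracket_dual cobracket_dualE.
split=> -[cm cs]; split.
- by move=> x y f h; rewrite -E cm tpair0l.
- by move=> f fW x y; rewrite -S cs // tpair0l.
- by move=> f h; apply: tens_dual_eq0 => x y; rewrite E.
by move=> f fW; apply: tens_dual_eq0 => x y; rewrite S cs.
Qed.

(** * Reduction to homogeneous arguments *)

(** Up to exchanging x and y, the three parity ranges leave out only two odd
    vectors with f even, and polarizing the squaring identity covers two
    odd vectors for every f. *)
Lemma cocycle_form_eq0 :
    {in V1, forall x f h, sq_form x f h = 0} ->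
    (forall x y f h, x \in V0 -> y \in V0 -> cocycle_form x y f h = 0) ->
    (forall x y f h, x \in V0 -> f \in W0 -> cocycle_form x y f h = 0) ->
    (forall x y f h, x \in V1 -> f \in W1 -> cocycle_form x y f h = 0) ->
  forall x y f h, cocycle_form x y f h = 0.
Proof.
move=> sq0 m00 m0e m1o x y f h.
have m11 u v : u \in V1 -> v \in V1 -> cocycle_form u v f h = 0.
  move=> uV vV; have := sq_form_polar f h uV vV.
  by rewrite !sq0 ?memvD // !add0r.
have m01 u v : u \in V0 -> v \in V1 -> cocycle_form u v f h = 0.
  move=> uV vV; have [f0 [f1 [f0W f1W ->]]] := homogeneous_decomp D f.
  by rewrite cocycle_formDf m0e // cocycle_formC m1o // addr0.
have [x0 [x1 [x0V x1V ->]]] := homogeneous_decomp L x.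
have [y0 [y1 [y0V y1V ->]]] := homogeneous_decomp L y.
rewrite cocycle_formDl ![cocycle_form _ (_ + _) _ _]cocycle_formC.
rewrite !cocycle_formDl m00 // (m01 y0 x1) //.
by rewrite [cocycle_form y1 x0 _ _]cocycle_formC m01 // m11 // !addr0.
Qed.

End Compatibility.

Unset Implicit Arguments.
Set Strict Implicit.

Theorem proposition3p3p1 (K : fieldType) (char2 : 2%N \in [pchar K])
    (g : vectType K) (g0 g1 : {vspace g})
    (Lg : lie_super g0 g1)
    (Ld : lie_super (ann g1) (ann g0)) :
  [/\ (* (1) *)
      forall (x : g) (h : 'Hom(g, K^o)), x \in g1 ->
        coad Ld (lie_sq Lg x) h =
          lie Lg x (coad Ld x h) + coad Ld x (dual_ad Lg h x),
      (* (2) *)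
      forall (y : g) (f : 'Hom(g, K^o)), f \in ann g0 ->
        dual_ad Lg (lie_sq Ld f) y =
          lie Ld f (dual_ad Lg f y) + dual_ad Lg f (coad Ld y f)
    & (* (3) *)
      [/\ forall (x y : g) (f : 'Hom(g, K^o)), x \in g0 -> y \in g0 ->
            compat_at Lg Ld x y f,
          forall (x y : g) (f : 'Hom(g, K^o)), x \in g0 -> f \in ann g1 ->
            compat_at Lg Ld x y f
        & forall (x y : g) (f : 'Hom(g, K^o)), x \in g1 -> f \in ann g0 ->
            compat_at Lg Ld x y f]]
  <->
  cocycle1 Lg (tens_act Lg) (cobracket Ld) /\
  cocycle1 Ld (tens_act Ld) (cobracket_dual Lg).
Proof.
rewrite cocycle1_cobracketE (cocycle1_cobracket_dualE char2).
split=> [[c1 c2 [c3 c4 c5]] | [[m0 sq0] [_ dsq0]]].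
  have sq0 : {in g1, forall x f h, sq_form Lg Ld x f h = 0}.
    by move=> x xg; apply/(coad_sqE char2) => h; apply: c1.
  have m0 : forall x y f h, cocycle_form Lg Ld x y f h = 0.
    apply: (cocycle_form_eq0 char2 sq0) => x y f h xg p; move: h;
      apply/(compat_atE char2); [exact: c3 | exact: c4 | exact: c5].
  do 2?split=> //; move=> f fg.
  by apply/(dual_ad_sqE char2) => y; apply: c2.
split.
- by move=> x h xg; move: h; apply/(coad_sqE char2)/sq0.
- by move=> y f fg; move: y; apply/(dual_ad_sqE char2)/dsq0.
by split=> x y f _ _; apply/(compat_atE char2) => h; apply: m0.
Qed.
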